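(* For all integers $n\ge 3$, $$\sqrt{2\pi n}\left(\frac{n}{e}\right)^n \exp\left(\frac{1}{12n+\frac{2}{5n}-\frac{1.1}{10n^3}}\right)\ \ge\ n!\ \ge\ \sqrt{2\pi n}\left(\frac{n}{e}\right)^n \exp\left(\frac{1}{12n+\frac{2}{5n}-\frac{0.9}{10n^3}}\right).$$
   Context: Here $e$ is the base of the natural logarithm, $\exp(x)=e^x$, and $n!$ is the usual factorial. *)

(* Defs.v *)
From Stdlib Require Export Reals Factorial.

(* Main.v *)
Require Import Defs.
From Stdlib Require Import Reals Factorial Lra Lia.
From Coquelicot Require Import Coquelicot.
Open Scope R_scope.

(** Taking logarithms, the claim is that
    [stirling_log n = ln n! - (n + 1/2) ln n + n] lies between
    [ln (2 pi) / 2 + correction (9/10) n] and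
    [ln (2 pi) / 2 + correction (11/10) n], where
    [correction c x = 1 / (12 x + 2 / (5 x) - c / (10 x^3))]. Since the
    corrections tend to 0 and [stirling_log] tends to [ln (2 pi) / 2]
    ([stirling_log_lim]), it is enough that [stirling_log - correction c] is
    nonincreasing for [c = 9/10] and nondecreasing for [c = 11/10], from
    [n = 3] on.

    This monotonicity compares one step of the correction with
    [stirling_log n - stirling_log (n+1) = (n + 1/2) ln (1 + 1/n) - 1], which
    in [v = 2n + 1] is the series [1/(3 v^2) + 1/(5 v^4) + 1/(7 v^6) + ...].
    The expansion of the exact correction corresponds to [c = 106/105] in the
    limit, so both comparisons have a margin of order [n^-6]; this is why the
    series is kept up to its third term ([stirling_increment_bounds]). What is
    left are two polynomial inequalities ([correction_step_le],
    [correction_step_ge]).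

    The value of the limit comes from Wallis: [2 stirling_log n -
    stirling_log (2n)] is the logarithm of a central binomial quotient, which
    the integrals of [sin^k] evaluate asymptotically. No separate convergence
    argument is needed, because the same monotonicity forces
    [stirling_log n - stirling_log (2n)] to 0. *)

(** * Wallis integrals *)

Definition wallis (k : nat) : R := RInt (fun x => sin x ^ k) 0 (PI / 2).

Lemma ex_RInt_sin_pow (k : nat) (a b : R) : ex_RInt (fun x => sin x ^ k) a b.
Proof.
  apply (ex_RInt_continuous (V := R_CompleteNormedModule)); intros x _.
  apply (ex_derive_continuous (fun x => sin x ^ k)).
  auto_derive; trivial.
Qed.

Lemma wallis_0 : wallis 0 = PI / 2.
Proof.
  unfold wallis; simpl.
  rewrite RInt_const; unfold scal; simpl; unfold mult; simpl; ring.
Qed.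

Lemma wallis_1 : wallis 1 = 1.
Proof.
  unfold wallis.
  apply is_RInt_unique.
  replace 1 with (minus (- cos (PI / 2)) (- cos 0))
    by (rewrite cos_PI2, cos_0; unfold minus, plus, opp; simpl; ring).
  apply (is_RInt_derive (fun x => - cos x)).
  - intros x _; auto_derive; trivial; ring.
  - intros x _. apply (ex_derive_continuous (fun x => sin x ^ 1)).
    auto_derive; trivial.
Qed.

(** Integration by parts in disguise: the integrand
    [(k+1) sin^k - (k+2) sin^(k+2)] is the derivative of [sin^(k+1) cos],
    which vanishes at both ends of the interval. *)
Lemma wallis_rec (k : nat) :
  (INR k + 2) * wallis (S (S k)) = (INR k + 1) * wallis k.
Proof.
  set (f x := (INR k + 1) * sin x ^ k - (INR k + 2) * sin x ^ S (S k)).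
  assert (H0 : is_RInt f 0 (PI / 2) 0).
  { replace 0 with (minus (sin (PI / 2) ^ S k * cos (PI / 2))
                          (sin 0 ^ S k * cos 0)) at 2
      by (rewrite cos_PI2, sin_0; unfold minus, plus, opp; simpl; ring).
    apply (is_RInt_derive (fun x => sin x ^ S k * cos x)).
    - intros x _; unfold f; auto_derive; trivial.
      change (match k with 0%nat => 1 | S _ => INR k + 1 end) with (INR (S k)).
      rewrite S_INR.
      replace (sin x ^ S (S k)) with (sin x ^ k * (sin x * sin x))
        by (simpl; ring).
      replace (sin x ^ S k) with (sin x ^ k * sin x) by (simpl; ring).
      pose proof (sin2_cos2 x) as H; unfold Rsqr in H.
      replace (sin x * sin x) with (1 - cos x * cos x) by lra.
      simpl pred.
      transitivity (sin x ^ k * ((INR k + 1) * (cos x * cos x)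
                                 - (sin x * sin x))); [ring|].
      replace (sin x * sin x) with (1 - cos x * cos x) by lra; ring.
    - intros x _. apply (ex_derive_continuous f).
      unfold f; auto_derive; trivial. }
  assert (H1 : is_RInt f 0 (PI / 2)
     (minus (scal (INR k + 1) (wallis k))
            (scal (INR k + 2) (wallis (S (S k)))))).
  { apply (is_RInt_minus (V := R_NormedModule)
      (fun x => scal (INR k + 1) (sin x ^ k))
      (fun x => scal (INR k + 2) (sin x ^ S (S k))));
    apply (is_RInt_scal (V := R_NormedModule));
    apply (RInt_correct (V := R_CompleteNormedModule));
    apply ex_RInt_sin_pow. }
  apply (is_RInt_unique (V := R_CompleteNormedModule)) in H0.
  apply (is_RInt_unique (V := R_CompleteNormedModule)) in H1.
  rewrite H0 in H1.
  unfold minus, plus, opp, scal in H1; simpl in H1.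
  unfold mult in H1; simpl in H1; lra.
Qed.

Lemma wallis_decr (k : nat) : wallis (S k) <= wallis k.
Proof.
  pose proof PI_RGT_0.
  apply RInt_le; [lra | apply ex_RInt_sin_pow | apply ex_RInt_sin_pow |].
  intros x Hx.
  assert (0 <= sin x) by (apply sin_ge_0; lra).
  pose proof (SIN_bound x).
  pose proof (pow_le (sin x) k H0).
  simpl; nra.
Qed.

Lemma wallis_mul (k : nat) : (INR k + 1) * wallis k * wallis (S k) = PI / 2.
Proof.
  induction k as [|k IH].
  - rewrite wallis_0, wallis_1; simpl; ring.
  - rewrite <- IH, S_INR.
    replace (INR k + 1 + 1) with (INR k + 2) by ring.
    transitivity ((INR k + 2) * wallis (S (S k)) * wallis (S k)); [ring|].
    rewrite wallis_rec; ring.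
Qed.

Lemma wallis_even (n : nat) :
  wallis (2 * n) = INR (fact (2 * n)) / (4 ^ n * INR (fact n) ^ 2) * (PI / 2).
Proof.
  induction n as [|n IH].
  - simpl Nat.mul; rewrite wallis_0; simpl; field.
  - pose proof (pos_INR n).
    replace (2 * S n)%nat with (S (S (2 * n))) by lia.
    apply (Rmult_eq_reg_l (INR (2 * n) + 2));
      [| rewrite mult_INR; simpl; lra].
    rewrite wallis_rec, IH.
    rewrite !fact_simpl, !mult_INR, !S_INR, mult_INR; simpl.
    field; repeat split; try lra.
    + apply INR_fact_neq_0.
    + apply pow_nonzero; lra.
Qed.

Lemma wallis_pos (k : nat) : 0 < wallis k.
Proof.
  assert (H0 : 0 <= wallis k).
  { pose proof PI_RGT_0.
    apply RInt_ge_0; [lra | apply ex_RInt_sin_pow |].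
    intros x Hx; apply pow_le, sin_ge_0; lra. }
  destruct H0 as [H0 | H0]; trivial.
  pose proof (wallis_mul k); pose proof PI_RGT_0.
  rewrite <- H0 in H; lra.
Qed.

(** Consecutive Wallis integrals are asymptotically equal, so their product
    [PI / (2 (k+1))] is asymptotic to the square of either one. *)
Lemma wallis_sqr_bounds (k : nat) :
  PI / 2 * (1 - / (INR k + 1)) <= INR k * wallis k ^ 2 <= PI / 2.
Proof.
  pose proof (pos_INR k).
  pose proof (wallis_mul k); pose proof (wallis_decr k).
  pose proof (wallis_decr (S k)); pose proof (wallis_rec k).
  pose proof (wallis_pos k); pose proof (wallis_pos (S k)).
  split.
  - replace (1 - / (INR k + 1)) with (INR k / (INR k + 1)) by (field; lra).
    rewrite <- H0.
    replace ((INR k + 1) * wallis k * wallis (S k) * (INR k / (INR k + 1)))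
      with (INR k * (wallis k * wallis (S k))) by (field; lra).
    apply Rmult_le_compat_l; [lra|]; nra.
  - assert (A : (INR k + 1) * wallis k <= (INR k + 2) * wallis (S k)) by nra.
    assert (B : INR k * wallis k <= (INR k + 1) * wallis (S k)).
    { apply (Rmult_le_reg_l (INR k + 2)); [lra|].
      apply Rle_trans with ((INR k + 1) * ((INR k + 1) * wallis k)); nra. }
    rewrite <- H0; nra.
Qed.

Lemma is_lim_seq_inv_INR : is_lim_seq (fun n => / INR n) 0.
Proof.
  replace (Finite 0) with (Rbar_inv p_infty) by reflexivity.
  apply is_lim_seq_inv; [apply is_lim_seq_INR | discriminate].
Qed.

Lemma wallis_sqr_lim : is_lim_seq (fun k => INR k * wallis k ^ 2) (PI / 2).
Proof.
  apply is_lim_seq_le_le with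
    (u := fun k => PI / 2 * (1 - / (INR k + 1))) (w := fun _ => PI / 2).
  - exact wallis_sqr_bounds.
  - replace (Finite (PI / 2)) with (Finite (PI / 2 * (1 - 0)))
      by (f_equal; ring).
    apply (is_lim_seq_scal_l _ (PI / 2) (1 - 0)).
    apply (is_lim_seq_minus' (fun _ => 1)); [apply is_lim_seq_const|].
    apply is_lim_seq_ext with (fun n => / INR (S n));
      [intros n; now rewrite S_INR|].
    apply -> (is_lim_seq_incr_1 (fun n => / INR n)).
    exact is_lim_seq_inv_INR.
  - apply is_lim_seq_const.
Qed.

(** * The logarithmic remainder *)

(** The logarithm of [n! / (sqrt n * (n / e)^n)]. *)
Definition stirling_log (n : nat) : R :=
  ln (INR (fact n)) - (INR n + / 2) * ln (INR n) + INR n.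

Lemma stirling_log_step (n : nat) : (1 <= n)%nat ->
  stirling_log n - stirling_log (S n)
  = (INR n + / 2) * (ln (INR n + 1) - ln (INR n)) - 1.
Proof.
  intros Hn; apply le_INR in Hn; simpl in Hn.
  unfold stirling_log.
  rewrite fact_simpl, mult_INR, ln_mult;
    [| apply lt_0_INR; lia | apply INR_fact_lt_0].
  rewrite !S_INR; ring.
Qed.

(** The combination is the logarithm of the central binomial quotient
    [4^n n!^2 / (2n)!], up to elementary factors. *)
Lemma stirling_log_double (n : nat) : (1 <= n)%nat ->
  2 * stirling_log n - stirling_log (2 * n)
  = ln PI - / 2 * ln (INR (2 * n) * wallis (2 * n) ^ 2).
Proof.
  intros Hn; apply le_INR in Hn; simpl in Hn.
  pose proof PI_RGT_0; pose proof (INR_fact_lt_0 n).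
  pose proof (INR_fact_lt_0 (2 * n)); pose proof (wallis_pos (2 * n)).
  assert (0 < 4 ^ n) by (apply pow_lt; lra).
  assert (0 < INR (fact n) ^ 2) by (apply pow_lt; lra).
  assert (E2 : INR (2 * n) = 2 * INR n) by (rewrite mult_INR; simpl; lra).
  assert (L4 : ln (4 ^ n) = 2 * INR n * ln 2).
  { rewrite ln_pow by lra.
    replace 4 with (2 * 2) by ring; rewrite ln_mult by lra; ring. }
  assert (W : ln (wallis (2 * n))
    = ln (INR (fact (2 * n))) - 2 * INR n * ln 2 - 2 * ln (INR (fact n))
      + (ln PI - ln 2)).
  { rewrite wallis_even, ln_mult; try lra.
    - unfold Rdiv; rewrite !ln_mult, !ln_Rinv, ln_mult, L4, ln_pow; try lra.
      + simpl; ring.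
      + now apply Rmult_lt_0_compat.
      + now apply Rinv_0_lt_compat, Rmult_lt_0_compat.
    - apply Rdiv_lt_0_compat; trivial; now apply Rmult_lt_0_compat. }
  unfold stirling_log.
  rewrite ln_mult, ln_pow, W, E2, ln_mult; try lra.
  - simpl; field.
  - now apply pow_lt.
Qed.

Lemma stirling_log_double_lim :
  is_lim_seq (fun n => 2 * stirling_log n - stirling_log (2 * n))
    (ln (2 * PI) / 2).
Proof.
  pose proof PI_RGT_0.
  apply is_lim_seq_ext_loc with
    (fun n => ln PI - / 2 * ln (INR (2 * n) * wallis (2 * n) ^ 2)).
  { exists 1%nat; intros n Hn; symmetry; now apply stirling_log_double. }
  replace (ln (2 * PI) / 2) with (ln PI - / 2 * ln (PI / 2)).
  2: { unfold Rdiv at 1; rewrite !ln_mult, ln_Rinv; lra. }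
  apply is_lim_seq_minus'; [apply is_lim_seq_const|].
  apply (is_lim_seq_scal_l _ (/ 2) (ln (PI / 2))).
  apply (is_lim_seq_continuous ln
    (fun n => INR (2 * n) * wallis (2 * n) ^ 2)).
  - apply continuity_pt_filterlim.
    apply (ex_derive_continuous ln); auto_derive; lra.
  - apply (is_lim_seq_subseq (fun k => INR k * wallis k ^ 2)).
    + apply eventually_subseq; intros n; lia.
    + exact wallis_sqr_lim.
Qed.

(** * Series bounds for the logarithm *)

Lemma nonneg_of_derive (f df : R -> R) (y : R) :
  0 <= y < 1 -> f 0 = 0 ->
  (forall t, 0 <= t < 1 -> is_derive f t (df t)) ->
  (forall t, 0 <= t < 1 -> 0 <= df t) -> 0 <= f y.
Proof.
  intros Hy H0 Hd Hp.
  destruct (MVT_gen f 0 y df) as (c & Hc & E).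
  - rewrite Rmin_left, Rmax_right by lra.
    intros x Hx; apply Hd; lra.
  - rewrite Rmin_left, Rmax_right by lra.
    intros x Hx; apply continuity_pt_filterlim.
    apply (ex_derive_continuous f); exists (df x); apply Hd; lra.
  - rewrite Rmin_left, Rmax_right in Hc by lra.
    rewrite H0 in E.
    assert (0 <= df c) by (apply Hp; lra).
    nra.
Qed.

Lemma ln_ratio_ge (y : R) : 0 <= y < 1 ->
  2 * (y + y ^ 3 / 3 + y ^ 5 / 5 + y ^ 7 / 7) <= ln (1 + y) - ln (1 - y).
Proof.
  intros Hy.
  apply Rminus_le_0.
  apply (nonneg_of_derive
    (fun y => ln (1 + y) - ln (1 - y)
              - 2 * (y + y ^ 3 / 3 + y ^ 5 / 5 + y ^ 7 / 7))
    (fun y => 2 * y ^ 8 / (1 - y ^ 2))); trivial.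
  - rewrite Rplus_0_r, Rminus_0_r; field.
  - intros t Ht; auto_derive; [repeat split; lra|].
    field; nra.
  - intros t Ht; apply Rdiv_le_0_compat; [|nra].
    assert (0 <= t ^ 8) by (apply pow_le; lra); lra.
Qed.

(** The tail [sum_(j >= 3) y^(2j+1) / (2j+1)] is dominated by the geometric
    series with all denominators replaced by 7. *)
Lemma ln_ratio_le (y : R) : 0 <= y < 1 ->
  ln (1 + y) - ln (1 - y)
  <= 2 * (y + y ^ 3 / 3 + y ^ 5 / 5 + y ^ 7 / (7 * (1 - y ^ 2))).
Proof.
  intros Hy.
  apply Rminus_le_0.
  apply (nonneg_of_derive
    (fun y => 2 * (y + y ^ 3 / 3 + y ^ 5 / 5 + y ^ 7 / (7 * (1 - y ^ 2)))
              - (ln (1 + y) - ln (1 - y)))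
    (fun y => 4 * y ^ 8 / (7 * (1 - y ^ 2) ^ 2))); trivial.
  - rewrite Rplus_0_r, Rminus_0_r; field.
  - intros t Ht; auto_derive; [repeat split; nra|].
    field; repeat split; nra.
  - intros t Ht; apply Rdiv_le_0_compat.
    + assert (0 <= t ^ 8) by (apply pow_le; lra); lra.
    + assert (0 < (1 - t ^ 2) ^ 2) by (apply pow_lt; nra); lra.
Qed.

(** The substitution [y = 1 / (2x+1)] turns [(1+y) / (1-y)] into
    [(x+1) / x], and its prefactor [x + 1/2] into [1 / (2y)]. *)
Lemma stirling_increment_bounds (x : R) : 1 <= x ->
  let v := 2 * x + 1 in
  / (3 * v ^ 2) + / (5 * v ^ 4) + / (7 * v ^ 6)
  <= (x + / 2) * (ln (x + 1) - ln x) - 1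
  <= / (3 * v ^ 2) + / (5 * v ^ 4) + / (7 * v ^ 4 * (v ^ 2 - 1)).
Proof.
  intros Hx v.
  assert (Hv : 3 <= v) by (unfold v; lra).
  assert (Hy : 0 <= / v < 1).
  { split; [apply Rlt_le, Rinv_0_lt_compat; lra|].
    rewrite <- Rinv_1; apply Rinv_lt_contravar; lra. }
  assert (E : ln (x + 1) - ln x = ln (1 + / v) - ln (1 - / v)).
  { replace (1 + / v) with ((x + 1) * (2 / v)) by (unfold v; field; lra).
    replace (1 - / v) with (x * (2 / v)) by (unfold v; field; lra).
    assert (0 < 2 / v) by (apply Rdiv_lt_0_compat; lra).
    rewrite !ln_mult by lra; ring. }
  rewrite E.
  replace (x + / 2) with (v / 2) by (unfold v; field).
  pose proof (ln_ratio_ge _ Hy) as Hl.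
  pose proof (ln_ratio_le _ Hy) as Hu.
  split.
  - apply Rmult_le_compat_l with (r := v / 2) in Hl; [|lra].
    apply Rle_trans with (2 := Rplus_le_compat_r (-1) _ _ Hl).
    right; field; lra.
  - apply Rmult_le_compat_l with (r := v / 2) in Hu; [|lra].
    apply Rle_trans with (1 := Rplus_le_compat_r (-1) _ _ Hu).
    right; field; split; nra.
Qed.

(** * The correction term *)

Definition correction (c x : R) : R :=
  1 / (12 * x + 2 / (5 * x) - c / (10 * x ^ 3)).

Lemma correction_den_pos (c x : R) : 1 <= x -> c <= 2 ->
  0 < 120 * x ^ 4 + 4 * x ^ 2 - c.
Proof. intros Hx Hc; assert (1 <= x ^ 2) by nra; nra. Qed.

Lemma correction_frac (c x : R) : 1 <= x -> c <= 2 ->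
  correction c x = 10 * x ^ 3 / (120 * x ^ 4 + 4 * x ^ 2 - c).
Proof.
  intros Hx Hc; pose proof (correction_den_pos c x Hx Hc).
  assert (0 < x ^ 3) by (apply pow_lt; lra).
  unfold correction.
  replace (12 * x + 2 / (5 * x) - c / (10 * x ^ 3))
    with ((120 * x ^ 4 + 4 * x ^ 2 - c) / (10 * x ^ 3)) by (field; lra).
  field; lra.
Qed.

Lemma correction_lim (c : R) : c <= 2 ->
  is_lim_seq (fun n => correction c (INR n)) 0.
Proof.
  intros Hc.
  apply is_lim_seq_le_le_loc with (u := fun _ => 0) (w := fun n => / INR n).
  - exists 1%nat; intros n Hn; apply le_INR in Hn; simpl in Hn.
    pose proof (correction_den_pos c _ Hn Hc).
    assert (0 < INR n ^ 3) by (apply pow_lt; lra).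
    rewrite correction_frac by trivial; split.
    + apply Rlt_le, Rdiv_lt_0_compat; lra.
    + apply Rminus_le_0.
      replace (/ INR n - 10 * INR n ^ 3 / (120 * INR n ^ 4 + 4 * INR n ^ 2 - c))
        with ((110 * INR n ^ 4 + 4 * INR n ^ 2 - c)
              / (INR n * (120 * INR n ^ 4 + 4 * INR n ^ 2 - c)))
        by (field; lra).
      apply Rdiv_le_0_compat; [| apply Rmult_lt_0_compat; lra].
      assert (1 <= INR n ^ 2) by nra; nra.
  - apply is_lim_seq_const.
  - exact is_lim_seq_inv_INR.
Qed.

Ltac nonneg :=
  repeat first [ apply Rplus_le_le_0_compat | apply Rmult_le_pos
               | apply pow_le | lra ].

(** Cleared of denominators and expanded in [t = x - 3], the inequality has
    only nonnegative coefficients. The shift by 3 is essential: the inequality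
    fails at [x = 2], where the exact correction corresponds to a value of [c]
    below 9/10. *)
Lemma correction_step_le (x : R) : 3 <= x ->
  correction (9 / 10) x - correction (9 / 10) (x + 1)
  <= (x + / 2) * (ln (x + 1) - ln x) - 1.
Proof.
  intros Hx.
  assert (H1 : 1 <= x) by lra; assert (H2 : 1 <= x + 1) by lra.
  apply Rle_trans with (2 := proj1 (stirling_increment_bounds x H1)).
  rewrite !correction_frac by lra.
  pose proof (correction_den_pos (9 / 10) x H1 ltac:(lra)) as D1.
  pose proof (correction_den_pos (9 / 10) (x + 1) H2 ltac:(lra)) as D2.
  set (v := 2 * x + 1).
  assert (Dv : 0 < 105 * v ^ 6)
    by (assert (0 < v ^ 6) by (apply pow_lt; unfold v; lra); lra).
  set (d1 := 120 * x ^ 4 + 4 * x ^ 2 - 9 / 10) in *.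
  set (d2 := 120 * (x + 1) ^ 4 + 4 * (x + 1) ^ 2 - 9 / 10) in *.
  apply Rminus_le_0.
  replace (_ - _) with
    (((35 * v ^ 4 + 21 * v ^ 2 + 15) * d1 * d2
      - 105 * v ^ 6 * (10 * x ^ 3 * d2 - 10 * (x + 1) ^ 3 * d1))
     / (105 * v ^ 6 * d1 * d2))
    by (field; repeat split; unfold v in *; lra).
  apply Rdiv_le_0_compat; [| now repeat (apply Rmult_lt_0_compat; [|assumption])].
  clear D1 D2 Dv; unfold d1, d2, v; clear d1 d2 v.
  assert (exists t, 0 <= t /\ x = t + 3) as (t & Ht & ->)
    by (exists (x - 3); lra).
  field_simplify; apply Rdiv_le_0_compat; [nonneg | lra].
Qed.

Lemma correction_step_ge (x : R) : 3 <= x ->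
  (x + / 2) * (ln (x + 1) - ln x) - 1
  <= correction (11 / 10) x - correction (11 / 10) (x + 1).
Proof.
  intros Hx.
  assert (H1 : 1 <= x) by lra; assert (H2 : 1 <= x + 1) by lra.
  apply Rle_trans with (1 := proj2 (stirling_increment_bounds x H1)).
  rewrite !correction_frac by lra.
  pose proof (correction_den_pos (11 / 10) x H1 ltac:(lra)) as D1.
  pose proof (correction_den_pos (11 / 10) (x + 1) H2 ltac:(lra)) as D2.
  set (v := 2 * x + 1).
  assert (Dv : 0 < 105 * v ^ 4)
    by (assert (0 < v ^ 4) by (apply pow_lt; unfold v; lra); lra).
  assert (Dw : 0 < v ^ 2 - 1) by (unfold v; nra).
  set (d1 := 120 * x ^ 4 + 4 * x ^ 2 - 11 / 10) in *.
  set (d2 := 120 * (x + 1) ^ 4 + 4 * (x + 1) ^ 2 - 11 / 10) in *.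
  apply Rminus_le_0.
  replace (_ - _) with
    ((105 * v ^ 4 * (v ^ 2 - 1)
        * (10 * x ^ 3 * d2 - 10 * (x + 1) ^ 3 * d1)
      - ((35 * v ^ 2 + 21) * (v ^ 2 - 1) + 15) * d1 * d2)
     / (105 * v ^ 4 * (v ^ 2 - 1) * d1 * d2))
    by (field; repeat split; unfold v in *; lra).
  apply Rdiv_le_0_compat; [| now repeat (apply Rmult_lt_0_compat; [|assumption])].
  clear D1 D2 Dv Dw; unfold d1, d2, v; clear d1 d2 v.
  assert (exists t, 0 <= t /\ x = t + 3) as (t & Ht & ->)
    by (exists (x - 3); lra).
  field_simplify; apply Rdiv_le_0_compat; [nonneg | lra].
Qed.

(** * Telescoping and passage to the limit *)

Lemma stirling_lower_decr (m n : nat) : (3 <= n <= m)%nat ->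
  stirling_log m - correction (9 / 10) (INR m)
  <= stirling_log n - correction (9 / 10) (INR n).
Proof.
  intros [Hn Hm]; induction Hm as [|m Hm IH]; [lra|].
  assert (3 <= m)%nat as H3 by lia.
  pose proof (stirling_log_step m ltac:(lia)) as E.
  apply le_INR in H3; simpl in H3.
  pose proof (correction_step_le (INR m) ltac:(lra)).
  rewrite S_INR in *; lra.
Qed.

Lemma stirling_upper_incr (m n : nat) : (3 <= n <= m)%nat ->
  stirling_log n - correction (11 / 10) (INR n)
  <= stirling_log m - correction (11 / 10) (INR m).
Proof.
  intros [Hn Hm]; induction Hm as [|m Hm IH]; [lra|].
  assert (3 <= m)%nat as H3 by lia.
  pose proof (stirling_log_step m ltac:(lia)) as E.
  apply le_INR in H3; simpl in H3.
  pose proof (correction_step_ge (INR m) ltac:(lra)).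
  rewrite S_INR in *; lra.
Qed.

(** [stirling_log n] differs from [2 stirling_log n - stirling_log (2n)] by an
    increment over the range from [n] to [2n], and the two monotonicity
    statements squeeze this increment to zero. *)
Lemma stirling_log_lim : is_lim_seq stirling_log (ln (2 * PI) / 2).
Proof.
  assert (H : forall c, c <= 2 ->
    is_lim_seq (fun n => correction c (INR n) - correction c (INR (2 * n))) 0).
  { intros c Hc.
    replace (Finite 0) with (Finite (0 - 0)) by (f_equal; ring).
    apply is_lim_seq_minus'; [now apply correction_lim|].
    apply (is_lim_seq_subseq (fun n => correction c (INR n)));
      [apply eventually_subseq; intros n; lia | now apply correction_lim]. }
  assert (D : is_lim_seq (fun n => stirling_log n - stirling_log (2 * n)) 0).
  { apply is_lim_seq_le_le_loc with
      (u := fun n => correction (9 / 10) (INR n)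
                     - correction (9 / 10) (INR (2 * n)))
      (w := fun n => correction (11 / 10) (INR n)
                     - correction (11 / 10) (INR (2 * n)));
      [| apply H; lra | apply H; lra].
    exists 3%nat; intros n Hn.
    pose proof (stirling_lower_decr (2 * n) n ltac:(lia)).
    pose proof (stirling_upper_incr (2 * n) n ltac:(lia)).
    lra. }
  apply is_lim_seq_ext with
    (fun n => (2 * stirling_log n - stirling_log (2 * n))
              - (stirling_log n - stirling_log (2 * n)));
    [intros n; ring|].
  replace (ln (2 * PI) / 2) with (ln (2 * PI) / 2 - 0) by ring.
  apply is_lim_seq_minus'; [exact stirling_log_double_lim | exact D].
Qed.

Lemma stirling_log_minus_correction_lim (c : R) : c <= 2 ->
  is_lim_seq (fun n => stirling_log n - correction c (INR n))
    (ln (2 * PI) / 2).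
Proof.
  intros Hc.
  replace (ln (2 * PI) / 2) with (ln (2 * PI) / 2 - 0) by ring.
  apply is_lim_seq_minus'; [exact stirling_log_lim | now apply correction_lim].
Qed.

Lemma stirling_log_ge (n : nat) : (3 <= n)%nat ->
  ln (2 * PI) / 2 + correction (9 / 10) (INR n) <= stirling_log n.
Proof.
  intros Hn.
  enough (ln (2 * PI) / 2 <= stirling_log n - correction (9 / 10) (INR n))
    by lra.
  apply (is_lim_seq_le_loc
    (fun m => stirling_log m - correction (9 / 10) (INR m))
    (fun _ => stirling_log n - correction (9 / 10) (INR n))
    (ln (2 * PI) / 2)
    (stirling_log n - correction (9 / 10) (INR n))).
  - exists n; intros m Hm; apply stirling_lower_decr; lia.
  - apply stirling_log_minus_correction_lim; lra.
  - apply is_lim_seq_const.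
Qed.

Lemma stirling_log_le (n : nat) : (3 <= n)%nat ->
  stirling_log n <= ln (2 * PI) / 2 + correction (11 / 10) (INR n).
Proof.
  intros Hn.
  enough (stirling_log n - correction (11 / 10) (INR n) <= ln (2 * PI) / 2)
    by lra.
  apply (is_lim_seq_le_loc
    (fun _ => stirling_log n - correction (11 / 10) (INR n))
    (fun m => stirling_log m - correction (11 / 10) (INR m))
    (stirling_log n - correction (11 / 10) (INR n))
    (ln (2 * PI) / 2)).
  - exists n; intros m Hm; apply stirling_upper_incr; lia.
  - apply is_lim_seq_const.
  - apply stirling_log_minus_correction_lim; lra.
Qed.

Lemma stirling_exp_form (n : nat) (r : R) : (1 <= n)%nat ->
  sqrt (2 * PI * INR n) * (INR n / exp 1) ^ n * exp r
  = exp (ln (2 * PI) / 2 + r + (INR n + / 2) * ln (INR n) - INR n).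
Proof.
  intros Hn; apply le_INR in Hn; simpl in Hn.
  pose proof PI_RGT_0; pose proof (exp_pos 1).
  assert (Hq : 0 < INR n / exp 1) by (apply Rdiv_lt_0_compat; lra).
  rewrite <- (exp_ln (sqrt (2 * PI * INR n))) by (apply sqrt_lt_R0; nra).
  rewrite <- (exp_ln ((INR n / exp 1) ^ n)) by (now apply pow_lt).
  rewrite <- !exp_plus; f_equal.
  rewrite <- Rpower_sqrt by nra.
  unfold Rpower; rewrite ln_exp, ln_pow by trivial.
  rewrite ln_mult by lra.
  unfold Rdiv; rewrite (ln_mult (INR n)), ln_Rinv, ln_exp;
    try lra; now apply Rinv_0_lt_compat.
Qed.

Lemma fact_exp_form (n : nat) :
  INR (fact n) = exp (stirling_log n + (INR n + / 2) * ln (INR n) - INR n).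
Proof.
  unfold stirling_log.
  rewrite <- (exp_ln (INR (fact n))) at 1 by apply INR_fact_lt_0.
  f_equal; ring.
Qed.

Lemma exp_le (x y : R) : x <= y -> exp x <= exp y.
Proof.
  intros [H | ->]; [now apply Rlt_le, exp_increasing | apply Rle_refl].
Qed.

Theorem mainTheorem2 : forall n : nat, (3 <= n)%nat ->
  sqrt (2 * PI * INR n) * (INR n / exp 1) ^ n
    * exp (1 / (12 * INR n + 2 / (5 * INR n) - 1.1 / (10 * INR n ^ 3)))
    >= INR (fact n)
  /\
  INR (fact n) >=
  sqrt (2 * PI * INR n) * (INR n / exp 1) ^ n
    * exp (1 / (12 * INR n + 2 / (5 * INR n) - 0.9 / (10 * INR n ^ 3))).
Proof.
  intros n Hn.
  replace 1.1 with (11 / 10) by lra; replace 0.9 with (9 / 10) by lra.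
  fold (correction (11 / 10) (INR n)) (correction (9 / 10) (INR n)).
  rewrite !stirling_exp_form by lia; rewrite fact_exp_form.
  pose proof (stirling_log_ge n Hn); pose proof (stirling_log_le n Hn).
  split; apply Rle_ge, exp_le; lra.
Qed.
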